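(* Let $A$ be a complex semisimple Banach algebra with identity. Then $\mathrm{Soc}\,A$ is a minimal two-sided ideal of $A$ if and only if the following two conditions are equivalent for every $a \in A$ and every $b \in \mathrm{Soc}\,A$: (i) $\rho(ax) \leq \rho(bx)$ for all $x \in A$; (ii) $a = \lambda b$ for some $\lambda \in \mathbb{C}$ with $|\lambda| \leq 1$.
   Context: $\rho(x)$ denotes the spectral radius of $x \in A$. $\mathrm{Soc}\,A$ is the socle of $A$ (the sum of the minimal left ideals of $A$, or $\{0\}$ if there are none); for semisimple $A$ it coincides with the set of $a \in A$ of finite rank, where $\mathrm{rank}(a) = \sup_{x \in A} \#(\sigma(xa) \setminus \{0\})$ and $\sigma$ denotes the spectrum. A minimal two-sided ideal means a two-sided ideal which does not contain any two-sided ideals other than $\{0\}$ and itself (so, by this convention, $\{0\}$ itself qualifies). *)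

(* Defs.v *)
From HB Require Import structures.
From mathcomp Require Import all_boot all_order all_algebra.
From mathcomp Require Import complex.
From mathcomp Require Import all_classical all_reals all_analysis.

Set Implicit Arguments.
Unset Strict Implicit.
Unset Printing Implicit Defensive.

Import Order.TTheory GRing.Theory Num.Theory.
Import numFieldNormedType.Exports.

Local Open Scope classical_set_scope.
Local Open Scope ring_scope.
Local Open Scope complex_scope.

(* Unital with bone != 0; no normalisation of `|bone| is required.  The product
   is not inherited from algType: a structure having both a ring product and a
   norm would be a join missing below numDomainType, which the hierarchy
   rejects.  The ring structure is put on the copy [alg A] instead. *)
HB.mixin Record CompleteNormedModule_isBanachAlgebra (K : numFieldType) A
    of CompleteNormedModule K A := {
  bone : A;
  bmul : A -> A -> A;
  bmulA : associative bmul;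
  bmul1x : left_id bone bmul;
  bmulx1 : right_id bone bmul;
  bmulDl : left_distributive bmul +%R;
  bmulDr : right_distributive bmul +%R;
  bone_neq0 : bone != 0;
  bscalerAl : forall (k : K) x y, k *: bmul x y = bmul (k *: x) y;
  bscalerAr : forall (k : K) x y, k *: bmul x y = bmul x (k *: y);
  ler_bnormM : forall x y, `|bmul x y| <= `|x| * `|y|
}.

#[short(type="banachAlgType")]
HB.structure Definition BanachAlgebra (K : numFieldType) :=
  {A of CompleteNormedModule K A & CompleteNormedModule_isBanachAlgebra K A}.

Definition alg (K : numFieldType) (A : banachAlgType K) : Type := A.

HB.instance Definition _ (K : numFieldType) (A : banachAlgType K) :=
  GRing.Lmodule.copy (alg A) A.

HB.instance Definition _ (K : numFieldType) (A : banachAlgType K) :=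
  GRing.Zmodule_isNzRing.Build (alg A)
    (@bmulA K A) (@bmul1x K A) (@bmulx1 K A) (@bmulDl K A) (@bmulDr K A)
    (@bone_neq0 K A).

HB.instance Definition _ (K : numFieldType) (A : banachAlgType K) :=
  GRing.Lmodule_isLalgebra.Build K (alg A) (@bscalerAl K A).

HB.instance Definition _ (K : numFieldType) (A : banachAlgType K) :=
  GRing.Lalgebra_isAlgebra.Build K (alg A) (@bscalerAr K A).

Definition left_ideal (K : numFieldType) (A : algType K) (I : set A) : Prop :=
  [/\ I 0,
      forall x y, I x -> I y -> I (x + y),
      forall (k : K) x, I x -> I (k *: x) &
      forall a x, I x -> I (a * x)].

Definition two_sided_ideal (K : numFieldType) (A : algType K) (I : set A) :
    Prop :=
  left_ideal I /\ forall x a, I x -> I (x * a).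

Definition maximal_left_ideal (K : numFieldType) (A : algType K) (M : set A) :
    Prop :=
  [/\ left_ideal M, M <> setT &
      forall I, left_ideal I -> M `<=` I -> I = M \/ I = setT].

Definition jacobson_radical (K : numFieldType) (A : algType K) : set A :=
  [set x | forall M, maximal_left_ideal M -> M x].

Arguments jacobson_radical {K} A _.

Definition semisimple (K : numFieldType) (A : algType K) : Prop :=
  jacobson_radical A = [set 0].

Definition minimal_left_ideal (K : numFieldType) (A : algType K) (L : set A) :
    Prop :=
  [/\ left_ideal L, L <> [set 0] &
      forall I, left_ideal I -> I `<=` L -> I = [set 0] \/ I = L].

(* The empty sum gives 0, so the socle is [set 0] when there is no minimal
   left ideal. *)
Definition socle (K : numFieldType) (A : algType K) : set A :=
  [set a | exists n (x : 'I_n -> A),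
     (forall i, exists2 L, minimal_left_ideal L & L (x i)) /\
     a = \sum_(i < n) x i].

Arguments socle {K} A _.

(* Unlike a minimal left ideal, [set 0] qualifies. *)
Definition minimal_two_sided_ideal (K : numFieldType) (A : algType K)
    (J : set A) : Prop :=
  two_sided_ideal J /\
  forall I, two_sided_ideal I -> I `<=` J -> I = [set 0] \/ I = J.

Definition invertible (K : numFieldType) (A : algType K) (x : A) : Prop :=
  exists y, y * x = 1 /\ x * y = 1.

Definition spectrum (K : numFieldType) (A : algType K) (x : A) : set K :=
  [set l | ~ invertible (l%:A - x)].

(* The norm of R[i] takes values in R[i] (on the real axis); Re brings it back
   to R, where suprema exist. *)
Definition spectral_radius (R : realType) (A : algType R[i]) (x : A) : R :=
  sup [set complex.Re `|l| | l in spectrum x].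

(* Main.v *)
Require Import Defs.
From HB Require Import structures.
From mathcomp Require Import all_boot all_order all_algebra.
From mathcomp Require Import cyclic separable cyclotomic.
From mathcomp Require Import complex ring lra.
From mathcomp Require Import all_classical all_reals all_analysis.

Set Implicit Arguments.
Unset Strict Implicit.
Unset Printing Implicit Defensive.

Import Order.TTheory GRing.Theory Num.Theory.
Import numFieldNormedType.Exports.

Local Open Scope classical_set_scope.
Local Open Scope ring_scope.
Local Open Scope complex_scope.

(** The implication from (ii) to (i) always holds, so the theorem is about (i)
    implying (ii).

    Suppose that the socle is minimal and nonzero.  By Brauer's lemma a minimal
    left ideal is [A p] with [p] idempotent ([minimal_left_ideal_idem]), and by
    the Gelfand-Mazur theorem the corner [p A p] consists of the scalar multiples
    of [p] ([minimal_corner_scalar]).  Every element [c] thus defines a bilinear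
    form by [p w c v p = phi(w c v) p].  The product of [c] with the rank one
    element [v p w] has spectral radius [|phi(w c v)|] ([spectral_radius_rank1]),
    so (i) says that the form of [a] is dominated pointwise by the form of [b].
    Such a form is a constant multiple, by some [l] with [|l| <= 1], of the form
    dominating it ([dominated_bilinear]).  Hence [z = a - l b] satisfies
    [z A p = 0], and minimality makes [z] annihilate the whole socle.  It remains
    to see that [z] itself vanishes: [b] has a right unit [e] in the socle
    ([socle_right_unit]), domination passes the right annihilator of [b] to [a]
    ([dominated_annihilator]), so [z = z e = 0].  The same right unit settles the
    case of a zero socle, where [e = 0] and so [a = a e = 0].

    Conversely, a proper nonzero ideal [I] inside the socle misses some minimal
    left ideal [L], and then [I] and [L] are orthogonal; for nonzero [a] in [I]
    and [c] in [L], [a] is dominated by [a + c] without being a multiple of it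
    ([dominated_minimal_socle]).

    The Gelfand-Mazur theorem is obtained without complex integration: the
    average of the resolvent over the [n]-th roots of unity on a small circle
    differs from its value at the centre by an error geometric in [n], and this
    is enough for a maximum principle ([submean_le0],
    [corner_spectrum_nonempty]). *)

(** * Left ideals, minimal left ideals and the socle *)

Lemma left_idealB (K : numFieldType) (A : algType K) (I : set A) x y :
  left_ideal I -> I x -> I y -> I (x - y).
Proof.
by move=> [_ ID IZ _] Ix Iy; apply: ID => //; rewrite -scaleN1r; apply: IZ.
Qed.

Lemma left_ideal_mulr (K : numFieldType) (A : algType K) (L : set A) (c : A) :
  left_ideal L -> left_ideal [set x * c | x in L].
Proof.
move=> [L0 LD LZ LM]; split.
- by exists 0; rewrite ?mul0r.
- move=> _ _ [x Lx <-] [y Ly <-]; exists (x + y); [exact: LD|exact: mulrDl].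
- by move=> k _ [x Lx <-]; exists (k *: x); rewrite -?scalerAl; first exact: LZ.
- by move=> a _ [x Lx <-]; exists (a * x); rewrite -?mulrA; first exact: LM.
Qed.

Lemma left_idealI_mulr (K : numFieldType) (A : algType K) (L I : set A)
    (c : A) :
  left_ideal L -> left_ideal I -> left_ideal [set x | L x /\ I (x * c)].
Proof.
move=> [L0 LD LZ LM] [I0 ID IZ IM]; split.
- by split; rewrite ?mul0r.
- move=> x y [Lx Ix] [Ly Iy]; split; first exact: LD.
  by rewrite mulrDl; apply: ID.
- move=> k x [Lx Ix]; split; first exact: LZ.
  by rewrite -scalerAl; apply: IZ.
- move=> a x [Lx Ix]; split; first exact: LM.
  by rewrite -mulrA; apply: IM.
Qed.

Lemma left_ideal0 (K : numFieldType) (A : algType K) :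
  left_ideal [set 0 : A].
Proof.
split=> //.
- by move=> x y -> ->; rewrite addr0.
- by move=> k x ->; rewrite scaler0.
- by move=> a x ->; rewrite mulr0.
Qed.

Lemma minimal_left_ideal_neq0 (K : numFieldType) (A : algType K) (L : set A) :
  minimal_left_ideal L -> exists2 x, L x & x != 0.
Proof.
move=> [[L0 _ _ _] Ln0 _]; apply: contrapT => nL; apply: Ln0.
apply/seteqP; split=> [x Lx|_ -> //] /=.
by apply/eqP; apply: contrapT => /negP x0; apply: nL; exists x.
Qed.

Lemma minimal_left_ideal_eq (K : numFieldType) (A : algType K) (L I : set A)
    (x : A) :
  minimal_left_ideal L -> left_ideal I -> I `<=` L -> I x -> x != 0 -> I = L.
Proof.
move=> [_ _ minL] idI IL Ix x0; case: (minL I idI IL) => // I0.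
by move: Ix; rewrite I0 /= => xE; rewrite xE eqxx in x0.
Qed.

(** Schur's lemma: right multiplication by [c] is a module map out of the
    simple module [L], so its kernel is trivial as soon as it is proper. *)
Lemma minimal_left_ideal_mulr (K : numFieldType) (A : algType K) (L : set A)
    (c y : A) :
  minimal_left_ideal L -> L y -> y * c != 0 ->
  minimal_left_ideal [set x * c | x in L].
Proof.
move=> minL Ly yc0; have idL : left_ideal L by case: minL.
split; first exact: left_ideal_mulr.
  move=> Lc0; have : [set x * c | x in L] (y * c) by exists y.
  by rewrite Lc0 /= => yc; rewrite yc eqxx in yc0.
move=> I idI ILc.
have [I0|/existsNP[z /not_implyP[Iz z0]]] := pselect (forall z, I z -> z = 0).
  by left; apply/seteqP; split=> [z /I0|_ ->] //; case: idI.
right; have [x Lx xz] := ILc z Iz.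
have /seteqP[_ sLI] : [set x | L x /\ I (x * c)] = L.
  apply: (@minimal_left_ideal_eq _ _ _ _ x) => //.
  - exact: left_idealI_mulr.
  - by move=> t [].
  - by split=> //; rewrite xz.
  - by apply/eqP => x0; apply: z0; rewrite -xz x0 mul0r.
by apply/seteqP; split=> // _ [t /sLI[_ It] <-].
Qed.

Lemma socleD (K : numFieldType) (A : algType K) (a b : A) :
  socle A a -> socle A b -> socle A (a + b).
Proof.
move=> [m [x [Lx ->]]] [n [y [Ly ->]]]; exists (m + n)%N.
exists (fun i => match fintype.split i with inl j => x j | inr k => y k end).
split; first by move=> i; case: (fintype.split i).
rewrite big_split_ord /=; congr (_ + _); apply: eq_bigr => i _.
- by rewrite (unsplitK (inl i)).
- by rewrite (unsplitK (inr i)).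
Qed.

Lemma socle_minimal (K : numFieldType) (A : algType K) (L : set A) (x : A) :
  minimal_left_ideal L -> L x -> socle A x.
Proof.
move=> minL Lx; exists 1%N, (fun=> x); split; first by move=> _; exists L.
by rewrite big_ord1.
Qed.

Lemma socle_ind (K : numFieldType) (A : algType K) (I : set A) :
  I 0 -> (forall x y, I x -> I y -> I (x + y)) ->
  (forall L, minimal_left_ideal L -> L `<=` I) -> socle A `<=` I.
Proof.
move=> I0 ID IL _ [n [x [Lx ->]]]; elim/big_ind: _ => // i _.
by have [L minL Lxi] := Lx i; exact: IL minL _ Lxi.
Qed.

Lemma socle0 (K : numFieldType) (A : algType K) : socle A 0.
Proof. by exists 0%N, (fun=> 0); split=> [[]//|]; rewrite big_ord0. Qed.

(** Stability on the right is Schur's lemma: a right translate of a minimal left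
    ideal is again minimal, or zero. *)
Lemma socle_two_sided (K : numFieldType) (A : algType K) :
  two_sided_ideal (socle A).
Proof.
split; first split.
- exact: socle0.
- exact: socleD.
- move=> k x; apply: (socle_ind (I := [set x | socle A (k *: x)])) => /=.
  + by rewrite scaler0; exact: socle0.
  + by move=> u v hu hv; rewrite scalerDr; exact: socleD.
  + move=> L minL u Lu; apply: (socle_minimal minL).
    by case: minL => -[_ _ LZ _] _ _; exact: LZ.
- move=> a x; apply: (socle_ind (I := [set x | socle A (a * x)])) => /=.
  + by rewrite mulr0; exact: socle0.
  + by move=> u v hu hv; rewrite mulrDr; exact: socleD.
  + move=> L minL u Lu; apply: (socle_minimal minL).
    by case: minL => -[_ _ _ LM] _ _; exact: LM.
- move=> x a; move: x.
  apply: (socle_ind (I := [set x | socle A (x * a)])) => /=.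
  + by rewrite mul0r; exact: socle0.
  + by move=> u v hu hv; rewrite mulrDl; exact: socleD.
  + move=> L minL u Lu /=; have [->|ua0] := eqVneq (u * a) 0.
      exact: socle0.
    by apply: (socle_minimal (minimal_left_ideal_mulr minL Lu ua0)); exists u.
Qed.

(** * Semiprimeness *)

(** If [z] were outside a maximal left ideal [M], then [M + A z] would be the
    whole algebra, so [1 - y z] would lie in [M] for some [y]; but no left
    invertible element lies in [M]. *)
Lemma jacobson_radicalP (K : numFieldType) (A : algType K) (z : A) :
  (forall y, exists u, u * (1 - y * z) = 1) -> jacobson_radical A z.
Proof.
move=> inv M [idM MnT maxM]; apply: contrapT => Mz; apply: MnT.
have [M0 MD MZ MM] := idM.
pose I := [set x | exists2 y, M (x - y * z) & True].
have idI : left_ideal I.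
  split.
  - by exists 0; rewrite // mul0r subr0.
  - move=> s t [y My _] [w Mw _]; exists (y + w) => //.
    by rewrite mulrDl opprD addrACA; exact: MD.
  - move=> k x [y My _]; exists (k *: y) => //.
    by rewrite -scalerAl -scalerBr; exact: MZ.
  - move=> a x [y My _]; exists (a * y) => //.
    by rewrite -mulrA -mulrBr; exact: MM.
have MI : M `<=` I by move=> x Mx; exists 0; rewrite // mul0r subr0.
have [IM|IT] := maxM I idI MI.
  by exfalso; apply: Mz; rewrite -IM; exists 1; rewrite // mul1r subrr.
have [y My _] : I 1 by rewrite IT.
have [u uy] := inv y.
apply/seteqP; split=> // x _; rewrite -[x]mulr1 -uy mulrA.
exact: MM.
Qed.

(** A semisimple algebra is semiprime: if [z A z = 0], every [y z] has square
    zero, so [1 - y z] has the inverse [1 + y z]. *)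
Lemma semiprime (K : numFieldType) (A : algType K) (z : A) :
  semisimple A -> (forall x, z * x * z = 0) -> z = 0.
Proof.
move=> ss zAz; suff : jacobson_radical A z by rewrite ss.
apply: jacobson_radicalP => y; exists (1 + y * z).
rewrite mulrDl mul1r mulrBr mulr1 -(mulrA y z) (mulrA z y z) zAz mulr0 subr0.
by rewrite subrK.
Qed.

(** Brauer's lemma: as [L L != 0], some [y] in [L] has [L y = L], and [f] in [L]
    with [f y = y] is idempotent because right multiplication by [y] is injective
    on [L]. *)
Lemma minimal_left_ideal_idem (K : numFieldType) (A : algType K) (L : set A) :
  semisimple A -> minimal_left_ideal L ->
  exists f, [/\ L f, f != 0, f * f = f & forall x, L x -> x * f = x].
Proof.
move=> ss minL; have idL : left_ideal L by case: minL.
have [_ LD LZ LM] := idL.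
have [x Lx x0] := minimal_left_ideal_neq0 minL.
have [y [t [Ly Lt ty0]]] : exists y t, [/\ L y, L t & t * y != 0].
  apply: contrapT => nLL; move/eqP: x0; apply; apply: semiprime => // a.
  rewrite -mulrA; apply/eqP; apply: contrapT => /negP h; apply: nLL.
  by exists (a * x), x; split=> //; exact: LM.
have y0 : y != 0 by apply: contraNneq ty0 => ->; rewrite mulr0.
have /seteqP[_ LLy] : [set s * y | s in L] = L.
  apply: (@minimal_left_ideal_eq _ _ _ _ (t * y)) => //.
  - exact: left_ideal_mulr.
  - by move=> _ [s Ls <-]; exact: LM.
  - by exists t.
have [f Lf fy] := LLy y Ly.
have inj s : L s -> s * y = 0 -> s = 0.
  move=> Ls sy; apply/eqP; apply: contrapT => /negP s0.
  have /seteqP[_ /(_ t Lt)[_ /= ty]] : [set x | L x /\ [set 0] (x * y)] = L.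
    apply: (@minimal_left_ideal_eq _ _ _ _ s) => //.
    - exact/left_idealI_mulr/left_ideal0.
    - by move=> u [].
  by rewrite ty eqxx in ty0.
have f0 : f != 0 by apply: contraNneq y0 => f0; rewrite -fy f0 mul0r.
have ff : f * f = f.
  apply/eqP; rewrite -subr_eq0; apply/eqP; apply: inj.
    by apply: left_idealB => //; exact: LM.
  by rewrite mulrBl -mulrA fy fy subrr.
exists f; split=> // s Ls.
have /seteqP[_ /(_ s Ls)[u Lu <-]] : [set s * f | s in L] = L.
  apply: (@minimal_left_ideal_eq _ _ _ _ (f * f)) => //.
  - exact: left_ideal_mulr.
  - by move=> _ [u Lu <-]; exact: LM.
  - by exists f.
  - by rewrite ff.
by rewrite -mulrA ff.
Qed.

(** Right units are built one minimal left ideal at a time: if [e] fixes the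
    earlier summands and [f] fixes [x - x e], then [e + f - e f] fixes both. *)
Lemma socle_right_unit (K : numFieldType) (A : algType K) (b : A) :
  semisimple A -> socle A b -> exists2 e, socle A e & b * e = b.
Proof.
move=> ss [n [x [Lx ->]]].
suff [e Se xe] : exists2 e, socle A e & forall i, x i * e = x i.
  by exists e => //; rewrite mulr_suml; apply: eq_bigr => i _; exact: xe.
have [[_ sD sZ sM] sMr] := socle_two_sided A.
elim: n x Lx => [|n IH] x Lx; first by exists 0; [exact: socle0|case].
have [e Se xe] := IH (fun i => x (lift ord0 i)) (fun i => Lx (lift ord0 i)).
have [f Sf xf] : exists2 f, socle A f &
    x ord0 * (1 - e) * f = x ord0 * (1 - e).
  have [->|c0] := eqVneq (x ord0 * (1 - e)) 0.
    by exists 0; [exact: socle0|rewrite mul0r].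
  have [L minL L0] := Lx ord0.
  have minL' := minimal_left_ideal_mulr minL L0 c0.
  have [f [Lf _ _ Hf]] := minimal_left_ideal_idem ss minL'.
  by exists f; [exact: socle_minimal Lf|apply: Hf; exists (x ord0)].
exists (e + (1 - e) * f); first by apply: sD => //; exact: sM.
move=> i; rewrite mulrDr mulrA; case: (unliftP ord0 i) => [j|] ->.
  by rewrite mulrBr mulr1 xe subrr mul0r addr0.
by rewrite xf mulrBr mulr1 addrC subrK.
Qed.

(** * Real-valued norms *)

(** The norms of [R[i]] and of [A] take their values on the real axis of [R[i]];
    their real parts can be compared, bounded and used with suprema. *)
Definition cabs (R : realType) (z : R[i]) : R := complex.Re `|z|.

Definition bnorm (R : realType) (A : banachAlgType R[i]) (x : alg A) : R :=
  complex.Re `|x : A|.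

Lemma ReK (R : realType) (z : R[i]) : 0 <= z -> (complex.Re z)%:C = z.
Proof. by move=> z0; apply: RRe_real; exact: ger0_real. Qed.

Lemma cabsE (R : realType) (z : R[i]) : (cabs z)%:C = `|z|.
Proof. exact: ReK. Qed.

Lemma cabs_ge0 (R : realType) (z : R[i]) : 0 <= cabs z.
Proof. by rewrite -ler0c cabsE. Qed.

Lemma cabsM (R : realType) (z t : R[i]) : cabs (z * t) = cabs z * cabs t.
Proof. exact: Normc.normcM. Qed.

Lemma cabsV (R : realType) (z : R[i]) : cabs z^-1 = (cabs z)^-1.
Proof. exact: Normc.normcV. Qed.

Lemma cabs0 (R : realType) : cabs (0 : R[i]) = 0.
Proof. exact: Normc.normc0. Qed.

Lemma cabs_eq0 (R : realType) (z : R[i]) : (cabs z == 0) = (z == 0).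
Proof.
apply/eqP/eqP => [z0|->]; last exact: cabs0.
exact: (@Normc.eq0_normc _ z).
Qed.

Lemma cabs1 (R : realType) : cabs (1 : R[i]) = 1.
Proof. exact: Normc.normc1. Qed.

Lemma cabsN (R : realType) (z : R[i]) : cabs (- z) = cabs z.
Proof. by rewrite /cabs normrN. Qed.

Lemma cabsD (R : realType) (z t : R[i]) : cabs (z + t) <= cabs z + cabs t.
Proof. exact: le_normcD. Qed.

Lemma cabsX (R : realType) (z : R[i]) n : cabs (z ^+ n) = cabs z ^+ n.
Proof.
by elim: n => [|n IH]; rewrite ?expr0 ?cabs1 // !exprS cabsM IH.
Qed.

Lemma cabs_real (R : realType) (r : R) : 0 <= r -> cabs r%:C = r.
Proof. by move=> r0; rewrite /cabs ger0_norm // lecR. Qed.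

Lemma bnormE (R : realType) (A : banachAlgType R[i]) (x : alg A) :
  (bnorm x)%:C = `|x : A|.
Proof. exact: ReK. Qed.

Lemma bnorm_ge0 (R : realType) (A : banachAlgType R[i]) (x : alg A) :
  0 <= bnorm x.
Proof. by rewrite -ler0c bnormE. Qed.

Lemma bnormM (R : realType) (A : banachAlgType R[i]) (x y : alg A) :
  bnorm (x * y) <= bnorm x * bnorm y.
Proof. by rewrite -lecR rmorphM /= !bnormE; exact: ler_bnormM. Qed.

Lemma bnormD (R : realType) (A : banachAlgType R[i]) (x y : alg A) :
  bnorm (x + y) <= bnorm x + bnorm y.
Proof. by rewrite -lecR rmorphD /= !bnormE; exact: ler_normD. Qed.

Lemma bnormN (R : realType) (A : banachAlgType R[i]) (x : alg A) :
  bnorm (- x) = bnorm x.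
Proof. by rewrite /bnorm (normrN (x : A)). Qed.

Lemma bnormZ (R : realType) (A : banachAlgType R[i]) (k : R[i]) (x : alg A) :
  bnorm (k *: x) = cabs k * bnorm x.
Proof.
by apply: complexI; rewrite rmorphM /= cabsE !bnormE; exact: normrZ.
Qed.

Lemma bnorm0 (R : realType) (A : banachAlgType R[i]) : bnorm (0 : alg A) = 0.
Proof. by rewrite -(scale0r 0) bnormZ cabs0 mul0r. Qed.

Lemma bnorm_le0 (R : realType) (A : banachAlgType R[i]) (x : alg A) :
  bnorm x <= 0 -> x = 0.
Proof. by rewrite -lecR bnormE normr_le0 => /eqP. Qed.

Lemma bnorm_sum (R : realType) (A : banachAlgType R[i]) (I : Type)
    (r : seq I) (F : I -> alg A) :
  bnorm (\sum_(i <- r) F i) <= \sum_(i <- r) bnorm (F i).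
Proof.
elim/big_ind2: _ => [|x a y b hx hy|//]; first by rewrite bnorm0.
by apply: le_trans (bnormD _ _) _; exact: lerD.
Qed.

Lemma bnormX (R : realType) (A : banachAlgType R[i]) (x : alg A) n :
  bnorm (x ^+ n) <= bnorm (1 : alg A) * bnorm x ^+ n.
Proof.
elim: n => [|n IH]; first by rewrite !expr0 mulr1.
rewrite !exprSr mulrA; apply: le_trans (bnormM _ _) _.
by apply: ler_wpM2r => //; exact: bnorm_ge0.
Qed.

(** * Neumann series and boundedness of the spectrum *)

Lemma geometric_lt (R : realType) (D q e : R) :
  0 <= q -> q < 1 -> 0 < e -> exists n, D * q ^+ n < e.
Proof.
move=> q0 q1 e0; have qn : `|q| < 1 by rewrite ger0_norm.
have /cvgrPdist_lt/(_ e e0)[n _ /(_ n (leqnn n))] /= :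
    (D * q ^+ n) @[n --> \oo] --> (0 : R).
  by rewrite -(mulr0 D); apply: cvgM; [exact: cvg_cst|exact: cvg_expr].
by rewrite sub0r normrN => h; exists n; apply: le_lt_trans h; exact: ler_norm.
Qed.

Lemma geometric_le0 (R : realType) (t D q : R) :
  0 <= q -> q < 1 -> (forall n, t <= D * q ^+ n) -> t <= 0.
Proof.
move=> q0 q1 tD; rewrite leNgt; apply/negP => t0.
by have [n] := geometric_lt D q0 q1 t0; rewrite ltNge tD.
Qed.

Lemma geometric_complete (R : realType) (A : banachAlgType R[i])
    (u : nat -> alg A) (D q : R) :
  0 <= q -> q < 1 ->
  (forall n k, bnorm (u (n + k)%N - u n) <= D * q ^+ n) ->
  exists y, forall n, bnorm (y - u n) <= D * q ^+ n.
Proof.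
move=> q0 q1 uD; pose v : nat -> A := u.
have cv : cvg (v n @[n --> \oo]).
  apply/cauchy_cvgP; apply: cauchy_exP => e e0.
  have eE : e = (complex.Re e)%:C by rewrite ReK // ltW.
  have e0' : 0 < complex.Re e by rewrite -ltcR -eE.
  have [n nD] := geometric_lt D q0 q1 e0'.
  exists (v n); exists n => // m /= nm.
  rewrite -ball_normE /ball_ /= -normrN opprB -[m](subnKC nm).
  by rewrite -(@bnormE _ A (u _ - u _)) eE ltcR; exact: le_lt_trans (uD _ _) nD.
pose y : A := lim (v n @[n --> \oo]); exists y => n.
apply/ler_addgt0Pl => e e0.
have eC : 0 < e%:C by rewrite ltcR.
have /cvgrPdist_lt/(_ _ eC)[m _ Hm] : v n @[n --> \oo] --> y by exact: cv.
have /= := Hm (n + m)%N (leq_addl _ _).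
rewrite -/y -(@bnormE _ A (y - u _)) ltcR => /ltW h.
rewrite -[y : alg A](subrK (u (n + m)%N)) -addrA.
by apply: le_trans (bnormD _ _) _; exact: lerD.
Qed.


Lemma geometric_sum_le (R : realType) (q : R) n :
  0 <= q -> q < 1 -> \sum_(i < n) q ^+ i <= (1 - q)^-1.
Proof.
move=> q0 q1; have q1' : 0 < 1 - q by rewrite subr_gt0.
rewrite -(ler_pM2l q1') mulfV ?gt_eqF //.
rewrite -[1 - q]opprB mulNr -subrX1 opprB.
by rewrite lerBlDr lerDl exprn_ge0.
Qed.

(** The partial sums [S n] of the Neumann series satisfy
    [S (n + k) - S n = x^n S k], so they converge at the rate [|x|^n]; the limit
    is an inverse because [(1 - x) S n = 1 - x^n]. *)
Lemma invertible_sub1 (R : realType) (A : banachAlgType R[i]) (x : alg A) :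
  bnorm x < 1 -> invertible (1 - x).
Proof.
move=> x1; have x0 := bnorm_ge0 x.
pose q := bnorm x; pose c := bnorm (1 : alg A); pose S n := \sum_(i < n) x ^+ i.
have c0 : 0 <= c := bnorm_ge0 _.
have SB n : bnorm (S n) <= c * (1 - q)^-1.
  apply: le_trans (bnorm_sum _ _) _.
  apply: (@le_trans _ _ (\sum_(i < n) c * q ^+ i)).
    by apply: ler_sum => i _; exact: bnormX.
  by rewrite -mulr_sumr ler_wpM2l //; exact: geometric_sum_le.
have SD n k : S (n + k)%N - S n = x ^+ n * S k.
  rewrite /S big_split_ord /= [X in X - _]addrC addrK mulr_sumr.
  by apply: eq_bigr => i _; rewrite exprD.
have [y yS] : exists y, forall n,
    bnorm (y - S n) <= (c * (c * (1 - q)^-1)) * q ^+ n.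
  apply: geometric_complete => // n k; rewrite SD mulrAC.
  apply: le_trans (bnormM _ _) _.
  by apply: ler_pM (bnorm_ge0 _) (bnorm_ge0 _) (bnormX _ _) (SB _).
set D := c * _ in yS.
have SxE n : (1 - x) * S n = 1 - x ^+ n.
  by rewrite -[1 - x]opprB mulNr -subrX1 opprB.
have xS n : x * S n = S n * x.
  rewrite mulr_sumr mulr_suml; apply: eq_bigr => i _.
  by rewrite -exprS -exprSr.
pose d := bnorm (1 - x).
exists y; split; apply/eqP; rewrite -subr_eq0; apply/eqP/bnorm_le0.
- apply: (@geometric_le0 _ _ (D * d + c) q) => // n.
  have -> : y * (1 - x) - 1 = (y - S n) * (1 - x) - x ^+ n.
    rewrite [in RHS]mulrBl.
    have -> : S n * (1 - x) = (1 - x) * S n.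
      by rewrite mulrBl mulrBr xS mul1r mulr1.
    by rewrite SxE opprB addrA addrAC addrK.
  apply: le_trans (bnormD _ _) _.
  rewrite bnormN [leRHS]mulrDl lerD //; last exact: bnormX.
  apply: le_trans (bnormM _ _) _; rewrite mulrAC.
  by apply: ler_wpM2r => //; exact: bnorm_ge0.
- apply: (@geometric_le0 _ _ (d * D + c) q) => // n.
  have -> : (1 - x) * y - 1 = (1 - x) * (y - S n) - x ^+ n.
    by rewrite [in RHS]mulrBr SxE opprB addrA addrAC addrK.
  apply: le_trans (bnormD _ _) _.
  rewrite bnormN [leRHS]mulrDl lerD //; last exact: bnormX.
  apply: le_trans (bnormM _ _) _; rewrite -mulrA.
  by apply: ler_wpM2l => //; exact: bnorm_ge0.
Qed.

Lemma spectrum_bound (R : realType) (A : banachAlgType R[i]) (x : alg A)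
    (l : R[i]) :
  spectrum x l -> cabs l <= bnorm x.
Proof.
move=> xl; rewrite leNgt; apply/negP => lx; apply: xl.
have l0 : l != 0.
  by rewrite -cabs_eq0 gt_eqF //; apply: le_lt_trans lx; exact: bnorm_ge0.
have l0' : 0 < cabs l by apply: le_lt_trans lx; exact: bnorm_ge0.
have [y [yx xy]] : invertible (1 - l^-1 *: x).
  by apply: invertible_sub1; rewrite bnormZ cabsV mulrC ltr_pdivrMr // mul1r.
have -> : l%:A - x = l *: (1 - l^-1 *: x).
  by rewrite scalerBr scalerA divff // scale1r.
exists (l^-1 *: y); split.
  by rewrite -scalerAl -scalerAr yx scalerA mulVf // scale1r.
by rewrite -scalerAl -scalerAr xy scalerA divff // scale1r.
Qed.

(** * The spectral radius *)

Lemma le_spectral_radius (R : realType) (A : banachAlgType R[i]) (x : alg A)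
    (l : R[i]) :
  spectrum x l -> cabs l <= spectral_radius x.
Proof.
move=> xl; apply: ub_le_sup; last by exists l.
by exists (bnorm x) => _ [k xk <-]; exact: spectrum_bound.
Qed.

Lemma spectral_radius_le (R : realType) (A : banachAlgType R[i]) (x : alg A)
    (c : R) :
  0 <= c -> (forall l, spectrum x l -> cabs l <= c) -> spectral_radius x <= c.
Proof.
move=> c0 xc; rewrite /spectral_radius.
set E := [set _ | _ in _]; have [->|/set0P nE] := eqVneq E set0.
  by rewrite sup0.
by apply: ge_sup => // _ [l xl <-]; exact: xc.
Qed.

Lemma spectral_radius_ge0 (R : realType) (A : banachAlgType R[i]) (x : alg A) :
  0 <= spectral_radius x.
Proof.
rewrite /spectral_radius.
set E := [set _ | _ in _]; have [->|/set0P[_ [l xl _]]] := eqVneq E set0.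
  by rewrite sup0.
exact: le_trans (cabs_ge0 l) (le_spectral_radius xl).
Qed.

Lemma spectrum0_le (R : realType) (A : banachAlgType R[i]) (l : R[i]) :
  spectrum (0 : alg A) l -> l = 0.
Proof.
move=> ln; apply/eqP; apply: contrapT => /negP l0; apply: ln.
exists (l^-1)%:A.
by rewrite subr0 -!scalerAl !mul1r !scalerA mulVf // divff // scale1r.
Qed.

Lemma spectral_radius0 (R : realType) (A : banachAlgType R[i]) :
  spectral_radius (0 : alg A) <= 0.
Proof. by apply: spectral_radius_le => // l /spectrum0_le ->; rewrite cabs0. Qed.

Lemma spectral_radiusZ (R : realType) (A : banachAlgType R[i]) (k : R[i])
    (x : alg A) :
  cabs k <= 1 -> spectral_radius (k *: x) <= spectral_radius x.
Proof.
move=> k1; have [->|k0] := eqVneq k 0.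
  rewrite scale0r; apply: le_trans (spectral_radius0 A) _.
  exact: spectral_radius_ge0.
apply: spectral_radius_le => [|l xl]; first exact: spectral_radius_ge0.
have {xl} : spectrum x (k^-1 * l).
  move=> [y [yx xy]]; apply: xl.
  have -> : l%:A - k *: x = k *: ((k^-1 * l)%:A - x).
    by rewrite scalerBr scalerA mulrA divff // mul1r.
  exists (k^-1 *: y); split.
    by rewrite -scalerAl -scalerAr yx scalerA mulVf // scale1r.
  by rewrite -scalerAl -scalerAr xy scalerA divff // scale1r.
move=> /le_spectral_radius; apply: le_trans.
rewrite cabsM cabsV ler_peMl ?cabs_ge0 // invf_ge1 //.
by rewrite lt_neqAle cabs_ge0 eq_sym cabs_eq0 k0.
Qed.

(** When [p q = q p = 0], [l - (p + q) = (l - p) (l - q) / l], so the nonzero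
    spectrum of [p] lies in that of [p + q]. *)
Lemma spectral_radius_orthoD (R : realType) (A : banachAlgType R[i])
    (p q : alg A) :
  p * q = 0 -> q * p = 0 -> spectral_radius p <= spectral_radius (p + q).
Proof.
move=> pq qp; apply: spectral_radius_le => [|l pl].
  exact: spectral_radius_ge0.
have [->|l0] := eqVneq l 0; first by rewrite cabs0; exact: spectral_radius_ge0.
apply: le_spectral_radius => -[y [yx xy]]; apply: pl.
have E1 : (l%:A - p) * (l%:A - q) = l *: (l%:A - (p + q)).
  rewrite mulrBl !mulrBr pq subr0 -!scalerAl !mul1r -scalerAr mulr1 opprD addrA.
  by rewrite !scalerBr addrAC.
have E2 : (l%:A - q) * (l%:A - p) = l *: (l%:A - (p + q)).
  rewrite mulrBl !mulrBr qp subr0 -!scalerAl !mul1r -scalerAr mulr1 opprD addrA.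
  by rewrite !scalerBr.
pose u := l^-1 *: ((l%:A - q) * y); pose v := l^-1 *: (y * (l%:A - q)).
have ul : (l%:A - p) * u = 1.
  by rewrite /u -scalerAr mulrA E1 -scalerAl xy scalerA mulVf // scale1r.
have vl : v * (l%:A - p) = 1.
  by rewrite /v -scalerAl -mulrA E2 -scalerAr yx scalerA mulVf // scale1r.
have uv : u = v by rewrite -[u]mul1r -vl -mulrA ul mulr1.
by exists u; split=> //; rewrite uv.
Qed.

(** The number [1] is never in the spectrum of [z y], so [1 - z y], and by
    Jacobson's identity [1 - y z], is invertible: [z] is in the radical. *)
Lemma spectral_radius_eq0 (R : realType) (A : banachAlgType R[i]) (z : alg A) :
  semisimple (alg A) -> (forall y, spectral_radius (z * y) <= 0) -> z = 0.
Proof.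
move=> ss zr; suff : jacobson_radical (alg A) z by rewrite ss.
apply: jacobson_radicalP => y.
have [u [uz zu]] : invertible (1 - z * y).
  rewrite -[1]scale1r; apply: contrapT => /le_spectral_radius.
  by rewrite cabs1 leNgt (le_lt_trans (zr y)).
exists (1 + y * u * z).
rewrite mulrDl mul1r mulrBr mulr1.
have -> : y * u * z * (y * z) = y * (u * (z * y)) * z by rewrite !mulrA.
have -> : u * (z * y) = u - 1.
  by rewrite -[X in _ = u - X]uz mulrBr mulr1 opprB addrC subrK.
by rewrite mulrBr mulr1 mulrBl subKr subrK.
Qed.

(** The element [u w] satisfies [(u w)^2 = c (u w)], so its spectrum lies in
    [{0, c}], and [c] is attained when it is nonzero. *)
Lemma spectral_radius_rank1 (R : realType) (A : banachAlgType R[i])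
    (p u w : alg A) (c : R[i]) :
  p != 0 -> u * p = u -> p * p = p -> w * u = c *: p ->
  spectral_radius (u * w) = cabs c.
Proof.
move=> p0 up pp wu; set q := u * w.
have qq : q * q = c *: q.
  by rewrite /q mulrA -(mulrA u) wu -scalerAr up -scalerAl.
apply/eqP; rewrite eq_le; apply/andP; split.
  apply: spectral_radius_le => [|l ql]; first exact: cabs_ge0.
  have [->|l0] := eqVneq l 0; first by rewrite cabs0 cabs_ge0.
  suff -> : l = c by [].
  apply/eqP; apply: contrapT => /negP; rewrite -subr_eq0 => lc; apply: ql.
  have [k kE] : exists k, k = l - c by exists (l - c).
  rewrite -kE in lc; have h : l * k != 0 by rewrite mulf_neq0.
  have E1 : (l%:A - q) * (k%:A + q) = (l * k)%:A.
    rewrite mulrBl !mulrDr qq -!scalerAl !mul1r -scalerAr mulr1 scalerA.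
    by rewrite -scalerDl kE subrK addrK.
  have E2 : (k%:A + q) * (l%:A - q) = (l * k)%:A.
    rewrite mulrDl !mulrBr qq -!scalerAl !mul1r -scalerAr mulr1 scalerA.
    by rewrite -scalerBl -kE subrK mulrC.
  exists ((l * k)^-1 *: (k%:A + q)).
  by rewrite -scalerAl -scalerAr E1 E2 !scalerA mulVf // scale1r.
have [->|c0] := eqVneq c 0; first by rewrite cabs0 spectral_radius_ge0.
apply: le_spectral_radius => -[y [yc _]].
have q0 : q = 0.
  rewrite -[q]mul1r -yc -mulrA mulrBl qq -scalerAl mul1r subrr mulr0 //.
have : w * q * u = 0 by rewrite q0 mulr0 mul0r.
rewrite /q !mulrA wu -mulrA wu -scalerAl -scalerAr pp => /eqP.
by rewrite !scaler_eq0 (negbTE c0) (negbTE p0).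
Qed.

(** * The Gelfand-Mazur theorem for corners *)

(** [X^n - 1] is separable when [n] is nonzero in [F], so it has [n] distinct
    roots, and a finite group of roots of unity is cyclic. *)
Lemma exists_prim_root (F : closedFieldType) n :
  n%:R != 0 :> F -> exists w : F, n.-primitive_root w.
Proof.
move=> nF; have n0 : (0 < n)%N by rewrite lt0n; apply: contraNneq nF => ->.
have [s] := closed_field_poly_normal ('X^n - 1 : {poly F}).
rewrite (monicP (monicXnsubC _ n0)) scale1r => Ds.
have /hasP[w _ wn] : has n.-primitive_root s; last by exists w.
apply: (has_prim_root n0).
- by apply/allP => z; rewrite -root_prod_XsubC -Ds.
- by rewrite -separable_prod_XsubC -Ds separable_Xn_sub_1.
- by rewrite -ltnS -(size_prod_XsubC s id) -Ds size_XnsubC.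
Qed.

Lemma prim_root_sum (F : fieldType) n (w : F) j :
  n.-primitive_root w -> (0 < j < n)%N -> \sum_(k < n) (w ^+ k) ^+ j = 0.
Proof.
move=> wn /andP[j0 jn].
have wj : w ^+ j - 1 != 0.
  by rewrite subr_eq0 -(prim_order_dvd wn) gtnNdvd.
apply: (mulfI wj); rewrite mulr0.
under eq_bigr do rewrite exprAC.
by rewrite -subrX1 exprAC (prim_expr_order wn) expr1n subrr.
Qed.

Lemma cabs_Re (R : realType) (z : R[i]) : `|complex.Re z| <= cabs z.
Proof.
case: z => a b; rewrite /cabs /= -sqrtr_sqr.
by rewrite ler_wsqrtr // lerDl sqr_ge0.
Qed.

Lemma cabs_Im (R : realType) (z : R[i]) : `|complex.Im z| <= cabs z.
Proof.
case: z => a b; rewrite /cabs /= -sqrtr_sqr.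
by rewrite ler_wsqrtr // lerDr sqr_ge0.
Qed.

Lemma cabs_le (R : realType) (a b : R) : cabs (a +i* b) <= `|a| + `|b|.
Proof.
have h : 0 <= `|a| + `|b| by rewrite addr_ge0.
rewrite /cabs /= -[leRHS]ger0_norm // -sqrtr_sqr ler_wsqrtr // sqrrD.
by rewrite !real_normK ?num_real // lerD2r lerDl mulrn_wge0 // mulr_ge0.
Qed.

(** Compactness of the square [[-K, K] x [-K, K]], read as a set of complex
    numbers. *)
Lemma locally_bounded_disc (R : realType) (N : R[i] -> R) (K : R) :
  (forall l, exists2 d, 0 < d &
     exists B, forall m, cabs (m - l) < d -> N m <= B) ->
  exists B, forall l, cabs l <= K -> N l <= B.
Proof.
move=> locN; pose Q := `[- K, K]%classic `*` `[- K, K]%classic : set (R * R).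
have cQ : compact Q by apply: compact_setX; exact: segment_compact.
have /compact_near_coveringP/(_ R (pinfty_nbhs R)
    (fun B z => N (z.1 +i* z.2) <= B) _) := cQ.
case=> [[a b] _|B [_ HB]].
  have [d d0 [B HB]] := locN (a +i* b).
  have d2 : 0 < d / 2 by rewrite divr_gt0.
  exists (ball (a, b) (d / 2), [set C | B < C]).
    split; first exact: nbhsx_ballx.
    by exists B; split=> //; exact: num_real.
  move=> [[a' b'] C] /= [[/= ha hb] BC].
  apply: le_trans (ltW BC); apply: HB.
  apply: le_lt_trans (_ : `|a' - a| + `|b' - b| < _).
    exact: (@cabs_le _ (a' - a) (b' - b)).
  rewrite [ltRHS]splitr ltrD // distrC; [exact: ha|exact: hb].
exists (B + 1) => l lK.
have := HB (B + 1); rewrite ltrDl ltr01 => /(_ isT (complex.Re l, complex.Im l)).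
have -> : complex.Re l +i* complex.Im l = l by case: (l).
apply; split; rewrite /= in_itv /= -ler_norml.
- exact: le_trans (cabs_Re _) lK.
- exact: le_trans (cabs_Im _) lK.
Qed.

(** A quantitative maximum principle.  If [N l] is within [d] of the supremum
    [M], averaging over [n] points of a circle about [l] forces every one of them,
    and in particular [l + s], to be within about [n d + n 4^-n M] of it.  As the
    step [s = 1 / (4 M)] does not depend on [l], near-maximality is carried
    arbitrarily far away, where [N] is small. *)
Lemma submean_le0 (R : realType) (N : R[i] -> R) (B : R) :
  (forall l, N l <= B) ->
  (forall e : R, 0 < e -> exists K, forall l, K < cabs l -> N l <= e) ->
  (forall (M s : R) (l : R[i]) n w,
     (forall m, N m <= M) -> 0 <= s -> s * M <= 4^-1 ->
     n.-primitive_root w ->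
     n%:R * N l <= \sum_(k < n) N (l + s%:C * w ^+ k) + n%:R * (4^-1 ^+ n * M)) ->
  forall l, N l <= 0.
Proof.
move=> NB Ndec Nmean l0; rewrite leNgt; apply/negP => N0.
pose E := range N; have supE : has_sup E.
  by split; [exists (N l0), l0|exists B => _ [l _ <-]].
pose M := sup E; have NM l : N l <= M.
  by apply: ub_le_sup; [case: supE|exists l].
have M0 : 0 < M := lt_le_trans N0 (NM _).
pose s := 4^-1 / M; have s0 : 0 < s by rewrite divr_gt0.
have step (e : R) : 0 < e -> exists2 d, 0 < d &
    forall l, M - d < N l -> M - e < N (l + s%:C).
  move=> e0; have e2 : 0 < e / 2 by rewrite divr_gt0.
  have [n Mn] : exists n, M * 2^-1 ^+ n < e / 2.
    by apply: geometric_lt; rewrite ?invr_ge0 ?invf_lt1 ?ltr1n.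
  have [w wn] : exists w : R[i], n.+1.-primitive_root w.
    by apply: exists_prim_root; rewrite pnatr_eq0.
  have n0 : 0 < n.+1%:R :> R by rewrite ltr0Sn.
  exists (e / 2 / n.+1%:R) => [|l Nl]; first by rewrite divr_gt0.
  have sM : s * M <= 4^-1 by rewrite /s divfK // gt_eqF.
  have := Nmean M s l n.+1 w NM (ltW s0) sM wn.
  rewrite big_ord_recl /= expr0 mulr1 => mean.
  (* The summand at [k = 0] is [N (l + s)]; the others are at most [M]. *)
  have rest : \sum_(i < n) N (l + s%:C * w ^+ bump 0 i) <= n%:R * M.
    apply: le_trans (_ : \sum_(i < n) M <= _); first by apply: ler_sum.
    by rewrite sumr_const card_ord mulr_natl.
  have err : n.+1%:R * (4^-1 ^+ n.+1 * M) <= M * 2^-1 ^+ n.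
    have -> : (4^-1 : R) ^+ n.+1 = 2^-1 ^+ n.+1 * 2^-1 ^+ n.+1.
      rewrite -exprMn; congr (_ ^+ _); rewrite -invfM; congr (_^-1).
      by rewrite -natrM.
    have h2 : n.+1%:R * 2^-1 ^+ n.+1 <= 1 :> R.
      rewrite exprVn ler_pdivrMr ?exprn_gt0 // mul1r -natrX ler_nat.
      by apply: ltnW; exact: ltn_expl.
    have h3 : 2^-1 ^+ n.+1 <= 2^-1 ^+ n :> R.
      by rewrite exprS ler_piMl ?exprn_ge0 ?invr_ge0 // invf_le1 ?ler1n.
    have h4 : 0 <= 2^-1 ^+ n.+1 :> R by rewrite exprn_ge0 // invr_ge0.
    move: (2^-1 ^+ n.+1) (2^-1 ^+ n) (n.+1%:R) h2 h3 h4 => h g c h2 h3 h4.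
    have -> : c * (h * h * M) = (c * h) * (M * h) by ring.
    apply: le_trans (_ : M * h <= _); last by rewrite ler_pM2l.
    by rewrite ler_piMl // mulr_ge0 // ltW.
  have Nl' : n%:R * M + M - e / 2 < n.+1%:R * N l.
    apply: le_lt_trans (_ : n.+1%:R * (M - e / 2 / n.+1%:R) < _).
      rewrite mulrBr -[in X in _ <= X - _]natr1 mulrDl mul1r lerD2l lerN2.
      by rewrite mulrC divfK // gt_eqF.
    by rewrite ltr_pM2l.
  move: mean rest err Nl' Mn.
  move: (\sum_(i < n) _) (n.+1%:R * N l) (n.+1%:R * (_ * M)) (M * _) (n%:R * M).
  by move: (N (l + _)) => *; lra.
have steps m (e : R) : 0 < e -> exists2 d, 0 < d &
    forall l, M - d < N l -> M - e < N (l + s%:C *+ m).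
  move=> e0; elim: m => [|m [d d0 Hd]].
    by exists e => // l; rewrite mulr0n addr0.
  have [d' d'0 Hd'] := step d d0; exists d' => // l /Hd'/Hd.
  by rewrite -addrA -mulrS.
have M2 : 0 < M / 2 by rewrite divr_gt0.
have [K HK] := Ndec (M / 2) M2.
have [m Km] : exists m, K + K < s * m%:R.
  exists (Num.bound `|(K + K) / s|); rewrite mulrC -ltr_pdivrMr //.
  by apply: le_lt_trans (ler_norm _) _; exact: archi_boundP.
have [d d0 Hd] := steps m _ M2.
have [|_ [l _ <-] Nl] := @sup_adherent _ E (Num.min d (M / 2)) _ supE.
  by rewrite lt_min d0.
have {}Hd : M - M / 2 < N (l + s%:C *+ m).
  by apply: Hd; apply: le_lt_trans Nl; rewrite lerD2l lerN2 ge_min lexx.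
have lK : cabs l <= K.
  rewrite leNgt; apply/negP => /HK; rewrite leNgt => /negP; apply.
  apply: le_lt_trans Nl; rewrite -/M lerBrDr.
  apply: le_trans (_ : M / 2 + M / 2 <= _); last by rewrite -splitr.
  by rewrite lerD2l ge_min lexx orbT.
have /HK : K < cabs (l + s%:C *+ m).
  have : cabs (s%:C *+ m) <= cabs (l + s%:C *+ m) + cabs l.
    by rewrite -[cabs l]cabsN -[X in cabs X <= _](addKr l) addrC; exact: cabsD.
  rewrite -mulr_natr cabsM (cabs_real (ltW s0)).
  have -> : cabs (m%:R : R[i]) = m%:R.
    by rewrite -(rmorph_nat (real_complex R)) cabs_real.
  lra.
lra.
Qed.

Lemma bnormXM (R : realType) (A : banachAlgType R[i]) (x y : alg A) n :
  bnorm (x ^+ n * y) <= bnorm x ^+ n * bnorm y.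
Proof.
elim: n => [|n IH]; first by rewrite !expr0 !mul1r.
rewrite !exprS -!mulrA; apply: le_trans (bnormM _ _) _.
by apply: ler_wpM2l => //; exact: bnorm_ge0.
Qed.

(** If [x - l p] were invertible in the corner [p A p] for every [l], the norm
    of the resolvent [r] would be bounded, small at infinity and, up to a
    geometric error, submean on small circles; by the maximum principle it would
    vanish.  The submean inequality comes from the resolvent identity iterated
    [n] times, [r(l + h) = sum_(j < n) h^j r(l)^(j+1) + h^n r(l)^n r(l + h)],
    averaged over [h = s w^k] with [w] a primitive [n]-th root of unity. *)
Lemma corner_spectrum_nonempty (R : realType) (A : banachAlgType R[i])
    (p x : alg A) :
  p != 0 -> p * x = x -> x * p = x ->
  exists l : R[i], ~ exists y, [/\ p * y = y, y * p = y,
    y * (x - l *: p) = p & (x - l *: p) * y = p].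
Proof.
move=> p0 px xp; apply: contrapT => /forallNP inv.
have {inv} /choice[r rP] : forall l : R[i], exists y,
    [/\ p * y = y, y * p = y, y * (x - l *: p) = p & (x - l *: p) * y = p].
  by move=> l; apply: contrapT; exact: inv.
have resolvent l m : r m = r l + (m - l) *: (r l * r m).
  have [_ rlp rlx _] := rP l; have [prm _ _ xrm] := rP m.
  have : r l * ((x - l *: p) - (x - m *: p)) * r m = r m - r l.
    by rewrite mulrBr mulrBl rlx prm -mulrA xrm rlp.
  have -> : (x - l *: p) - (x - m *: p) = (m - l) *: p.
    by rewrite opprB addrC addrA subrK scalerBl.
  by rewrite -scalerAr rlp -scalerAl => ->; rewrite addrC subrK.
pose N l := bnorm (r l).
have N0 l : 0 <= N l := bnorm_ge0 _.
(* The resolvent at most doubles on a disc of radius [1 / (2 N l)]. *)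
have near l m : cabs (m - l) * N l <= 2^-1 -> N m <= 2 * N l.
  move=> h; have : N m <= N l + (cabs (m - l) * N l) * N m.
    rewrite {1}/N (resolvent l m); apply: le_trans (bnormD _ _) _.
    rewrite lerD2l bnormZ -mulrA ler_wpM2l ?cabs_ge0 //.
    exact: bnormM.
  have : (cabs (m - l) * N l) * N m <= 2^-1 * N m by rewrite ler_wpM2r.
  move: (_ * _ * N m) => t; lra.
have decay l : (cabs l - bnorm x) * N l <= bnorm p.
  have [_ rlp rlx _] := rP l.
  have E : l *: r l = r l * x - p by rewrite -rlx mulrBr -scalerAr rlp subKr.
  rewrite mulrBl lerBlDr -bnormZ E [leRHS]addrC [in leRHS]mulrC.
  apply: le_trans (bnormD _ _) _; rewrite bnormN lerD2r; exact: bnormM.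
have far (e : R) : 0 < e -> exists K, forall l, K < cabs l -> N l <= e.
  move=> e0; exists (bnorm x + bnorm p / e) => l Kl.
  have d0 : 0 < cabs l - bnorm x.
    rewrite subr_gt0; apply: le_lt_trans Kl; rewrite lerDl.
    by rewrite divr_ge0 ?bnorm_ge0 // ltW.
  rewrite -(ler_pM2l d0); apply: le_trans (decay l) _.
  by rewrite -ler_pdivrMr // lerBrDl ltW.
have [B NB] : exists B, forall l, N l <= B.
  have [K HK] := far 1 ltr01.
  have [l|C HC] := @locally_bounded_disc R N K.
    have d0 : 0 < 2 * N l + 1 by rewrite ltr_wpDl // mulr_ge0.
    exists (2 * N l + 1)^-1; first by rewrite invr_gt0.
    exists (2 * N l) => m ml; apply: near.
    have h : cabs (m - l) * (2 * N l + 1) <= 1.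
      by rewrite -ler_pdivlMr // mul1r ltW.
    have := cabs_ge0 (m - l); move: (cabs _) h (N0 l) => t h Nl0 t0.
    have : t * (2 * N l + 1) = 2 * (t * N l) + t by ring.
    move: h; move: (_ * N l) (t * _) => *; lra.
  exists (Num.max 1 C) => l; rewrite le_max.
  by have [/HC ->|/HK ->] := leP (cabs l) K; rewrite ?orbT.
suff r0 : r 0 = 0.
  by move/eqP: p0; apply; have [_ _ <- _] := rP 0; rewrite r0 mul0r.
apply: bnorm_le0; move: (0 : R[i]).
apply: (@submean_le0 R N B NB far) => M s l n w NM s0 sM wn.
pose h k : R[i] := s%:C * w ^+ k.
have n0 : (0 < n)%N := prim_order_gt0 wn.
have iter k m : r (l + h k) =
    \sum_(j < m) h k ^+ j *: r l ^+ j.+1 + h k ^+ m *: (r l ^+ m * r (l + h k)).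
  elim: m => [|m IH]; first by rewrite big_ord0 add0r !expr0 mul1r scale1r.
  rewrite big_ord_recr /= -addrA {1}IH; congr (_ + _).
  rewrite {1}(resolvent l (l + h k)) addrAC subrr add0r mulrDr scalerDr -exprSr.
  by rewrite -scalerAr scalerA -exprSr mulrA -exprSr.
have avg : \sum_(k < n) r (l + h k) = n%:R *: r l +
    \sum_(k < n) h k ^+ n *: (r l ^+ n * r (l + h k)).
  under eq_bigr do rewrite (iter _ n).
  rewrite big_split /=; congr (_ + _).
  rewrite exchange_big /=; case: n n0 wn {iter} => // n _ wn.
  rewrite big_ord_recl /= [X in _ + X]big1 => [|j _].
    under eq_bigr do rewrite expr0 expr1 scale1r.
    by rewrite addr0 sumr_const card_ord scaler_nat.
  rewrite -scaler_suml; under eq_bigr do rewrite exprMn.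
  rewrite -mulr_sumr (prim_root_sum wn) ?mulr0 ?scale0r //=.
  exact: ltn_ord j.
have cw k : cabs (h k) = s.
  rewrite cabsM cabs_real // cabsX.
  suff -> : cabs w = 1 by rewrite expr1n mulr1.
  apply/eqP; rewrite -(@pexpr_eq1 _ _ n) ?cabs_ge0 //.
  by rewrite -cabsX (prim_expr_order wn) cabs1.
have M0 : 0 <= M := le_trans (N0 l) (NM l).
have err k : bnorm (h k ^+ n *: (r l ^+ n * r (l + h k))) <= 4^-1 ^+ n * M.
  rewrite bnormZ cabsX cw.
  apply: le_trans (_ : s ^+ n * (N l ^+ n * N (l + h k)) <= _).
    by rewrite ler_wpM2l ?exprn_ge0 //; exact: bnormXM.
  rewrite mulrA -exprMn ler_pM ?exprn_ge0 ?mulr_ge0 //.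
  rewrite lerXn2r ?nnegrE ?mulr_ge0 ?invr_ge0 //.
  by apply: le_trans sM; exact: ler_wpM2l.
have -> : n%:R * N l = bnorm (n%:R *: r l).
  rewrite bnormZ; congr (_ * _).
  by rewrite -(rmorph_nat (real_complex R)) cabs_real.
have -> : n%:R *: r l = \sum_(k < n) r (l + h k) -
    \sum_(k < n) h k ^+ n *: (r l ^+ n * r (l + h k)) by rewrite avg addrK.
apply: le_trans (bnormD _ _) _; rewrite bnormN; apply: lerD.
  exact: bnorm_sum.
apply: le_trans (bnorm_sum _ _) _.
apply: le_trans (_ : \sum_(k < n) 4^-1 ^+ n * M <= _).
  by apply: ler_sum => k _; exact: err.
by rewrite sumr_const card_ord mulr_natl.
Qed.

(** The corner [p A p] of a minimal idempotent is a division algebra: a nonzero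
    [x] in it generates [A p], so it has a left inverse there, which in turn has
    one. *)
Lemma minimal_corner_scalar (R : realType) (A : banachAlgType R[i])
    (L : set (alg A)) (p : alg A) :
  minimal_left_ideal L -> L p -> p != 0 -> p * p = p ->
  (forall x, L x -> x * p = x) ->
  forall x, exists c : R[i], p * x * p = c *: p.
Proof.
move=> minL Lp p0 pp Lr x0.
have [_ _ _ LM] : left_ideal L by case: minL.
have linv x : p * x = x -> x * p = x -> x != 0 ->
    exists y, [/\ p * y = y, y * p = y & y * x = p].
  move=> px xp xn0.
  have /seteqP[_ /(_ p Lp)[u Lu ux]] : [set a * x | a in L] = L.
    apply: (@minimal_left_ideal_eq _ _ _ _ x) => //.
    - by apply: left_ideal_mulr; case: minL.
    - by move=> _ [a _ <-]; rewrite -xp mulrA; exact: LM.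
    - by exists p.
  exists (p * u); split; first by rewrite mulrA pp.
  - by rewrite -mulrA Lr.
  - by rewrite -mulrA ux.
pose x := p * x0 * p.
have px : p * x = x by rewrite /x !mulrA pp.
have xp : x * p = x by rewrite /x -mulrA pp.
have [c nc] := corner_spectrum_nonempty p0 px xp; exists c.
apply/eqP; rewrite -subr_eq0 -/x; apply: contrapT => /negP h; apply: nc.
set z := x - c *: p in h *.
have pz : p * z = z by rewrite mulrBr px -scalerAr pp.
have zp : z * p = z by rewrite mulrBl xp -scalerAl pp.
have [y [py yp yz]] := linv z pz zp h; exists y; split=> //.
have y0 : y != 0 by apply: contraNneq p0 => y0; rewrite -yz y0 mul0r.
have [t [_ tp ty]] := linv y py yp y0.
suff -> : z = t by [].
by rewrite -tp -yz mulrA ty pz.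
Qed.

(** * Dominated bilinear forms *)

Definition bilinear_form (K : fieldType) (V W : lmodType K)
    (f : V -> W -> K) : Prop :=
  [/\ forall v v' w, f (v + v') w = f v w + f v' w,
      forall k v w, f (k *: v) w = k * f v w,
      forall v w w', f v (w + w') = f v w + f v w' &
      forall k v w, f v (k *: w) = k * f v w].

(** The vector [g y x - g x y] is killed by [g], hence by [f]. *)
Lemma dominated_linear (K : numFieldType) (V : lmodType K) (f g : V -> K) :
  (forall x y, f (x + y) = f x + f y) -> (forall k x, f (k *: x) = k * f x) ->
  (forall x y, g (x + y) = g x + g y) -> (forall k x, g (k *: x) = k * g x) ->
  (forall x, `|f x| <= `|g x|) ->
  forall x y, f x * g y = g x * f y.
Proof.
move=> fD fZ gD gZ fg x y.
have := fg (g y *: x + (- g x) *: y).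
rewrite gD !gZ mulNr [g y * g x]mulrC subrr normr0 normr_le0 fD !fZ mulNr.
by rewrite subr_eq0 => /eqP <-; rewrite mulrC.
Qed.

(** For fixed [v], or fixed [w], the quotient [f / g] is constant by
    [dominated_linear].  To join two points [(v0, w0)] and [(v, w)] with
    [g != 0] by such moves it may be necessary to go through [w + w0]. *)
Lemma dominated_bilinear (K : numFieldType) (V W : lmodType K)
    (f g : V -> W -> K) :
  bilinear_form f -> bilinear_form g ->
  (forall v w, `|f v w| <= `|g v w|) ->
  exists2 l : K, `|l| <= 1 & forall v w, f v w = l * g v w.
Proof.
move=> [fDl fZl fDr fZr] [gDl gZl gDr gZr] fg.
have [g0|/existsNP[v0 /existsNP[w0 /eqP g0]]] :=
    pselect (forall v w, g v w = 0).
  exists 0; rewrite ?normr0 ?ler01 // => v w; rewrite mul0r; apply/eqP.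
  by rewrite -normr_le0 (le_trans (fg v w)) // g0 normr0.
have eqr v w w' : f v w * g v w' = g v w * f v w'.
  by apply: (dominated_linear (f := f v) (g := g v)) => *.
have eql v v' w : f v w * g v' w = g v w * f v' w.
  by apply: (dominated_linear (f := f^~ w) (g := g^~ w)) => *.
have ratr v w w' : g v w != 0 -> g v w' != 0 -> f v w / g v w = f v w' / g v w'.
  by move=> h h'; apply/eqP; rewrite eqr_div // eqr mulrC.
have ratl v v' w : g v w != 0 -> g v' w != 0 -> f v w / g v w = f v' w / g v' w.
  by move=> h h'; apply/eqP; rewrite eqr_div // eql mulrC.
exists (f v0 w0 / g v0 w0).
  by rewrite normrM normfV ler_pdivrMr ?normr_gt0 // mul1r.
move=> v w; have [gvw|gvw] := eqVneq (g v w) 0.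
  by apply/eqP; rewrite gvw mulr0 -normr_le0 (le_trans (fg v w)) // gvw normr0.
suff <- : f v w / g v w = f v0 w0 / g v0 w0 by rewrite divfK.
have [g1|g1] := eqVneq (g v0 w) 0; last by rewrite (ratl v v0) // (ratr v0 w w0).
have [g2|g2] := eqVneq (g v w0) 0; last by rewrite (ratr v w w0) // (ratl v v0).
have h : g v (w + w0) != 0 by rewrite gDr g2 addr0.
have h0 : g v0 (w + w0) != 0 by rewrite gDr g1 add0r.
by rewrite (ratr v w (w + w0)) // (ratl v v0) // (ratr v0 _ w0).
Qed.

(** * Spectral domination *)

Lemma dominated_annihilator (R : realType) (A : banachAlgType R[i])
    (a b y : alg A) :
  semisimple (alg A) ->
  (forall x, spectral_radius (a * x) <= spectral_radius (b * x)) ->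
  b * y = 0 -> a * y = 0.
Proof.
move=> ss ab by0; apply: spectral_radius_eq0 => // x.
rewrite -mulrA; apply: le_trans (ab _) _.
by rewrite mulrA by0 mul0r; exact: spectral_radius0.
Qed.

(** Testing the domination on the rank one elements [v p w] compares the
    coefficients of [a] and [b], viewed as forms [w, v |-> p w a v p]. *)
Lemma dominated_corner (R : realType) (A : banachAlgType R[i])
    (a b p : alg A) :
  p != 0 -> p * p = p ->
  (forall x, exists c : R[i], p * x * p = c *: p) ->
  (forall x, spectral_radius (a * x) <= spectral_radius (b * x)) ->
  exists2 l : R[i], `|l| <= 1 &
    forall v w, p * (w * (a - l *: b) * v) * p = 0.
Proof.
move=> p0 pp /choice[phi phiE] ab.
have phiI x c : p * x * p = c *: p -> phi x = c.
  move=> xc; apply/eqP; rewrite -subr_eq0.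
  have : (phi x - c) *: p = 0 by rewrite scalerBl -phiE xc subrr.
  by move/eqP; rewrite scaler_eq0 (negbTE p0) orbF.
have phiD x y : phi (x + y) = phi x + phi y.
  by apply: phiI; rewrite mulrDr mulrDl !phiE scalerDl.
have phiZ k x : phi (k *: x) = k * phi x.
  by apply: phiI; rewrite -scalerAr -scalerAl phiE scalerA.
have form c : bilinear_form (fun v w : alg A => phi (w * c * v)).
  split=> [v v' w|k v w|v w w'|k v w].
  - by rewrite mulrDr phiD.
  - by rewrite -scalerAr phiZ.
  - by rewrite !mulrDl phiD.
  - by rewrite -!scalerAl phiZ.
have rad c v w : spectral_radius (c * (v * p * (p * w))) = cabs (phi (w * c * v)).
  have -> : c * (v * p * (p * w)) = (c * v * p) * (p * w) by rewrite !mulrA.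
  apply: (@spectral_radius_rank1 _ _ p) => //; first by rewrite -[LHS]mulrA pp.
  by rewrite -phiE !mulrA.
have [v w|l l1 El] := dominated_bilinear (form a) (form b).
  by rewrite -!cabsE lecR -!rad.
exists l => // v w; rewrite phiE.
rewrite mulrBr mulrBl -scalerAr -scalerAl -scaleN1r phiD !phiZ El mulN1r subrr.
by rewrite scale0r.
Qed.

(** A nonzero socle that is minimal is the two-sided ideal generated by any
    minimal idempotent [p].  The domination gives [z A p = 0] for
    [z = a - l b], so [z] annihilates the socle; and [z = z e] for a right unit
    [e] of [b] in the socle, because [a] kills [1 - e] as [b] does. *)
Lemma minimal_socle_dominated (R : realType) (A : banachAlgType R[i])
    (a b : alg A) :
  semisimple (alg A) -> minimal_two_sided_ideal (socle (alg A)) ->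
  socle (alg A) b ->
  (forall x, spectral_radius (a * x) <= spectral_radius (b * x)) ->
  exists2 l : R[i], `|l| <= 1 & a = l *: b.
Proof.
move=> ss [_ minS] Sb ab; have [e Se be] := socle_right_unit ss Sb.
have ae : a * e = a.
  have : a * (1 - e) = 0.
    by apply: (dominated_annihilator ss ab); rewrite mulrBr mulr1 be subrr.
  by rewrite mulrBr mulr1 => /eqP; rewrite subr_eq0 => /eqP <-.
suff [l l1 Hl] : exists2 l : R[i], `|l| <= 1 &
    forall x, socle (alg A) x -> (a - l *: b) * x = 0.
  exists l => //; apply/eqP; rewrite -subr_eq0; apply/eqP.
  by rewrite -[RHS](Hl e Se) mulrBl ae -scalerAl be.
have [[L minL]|noL] := pselect (exists L : set (alg A), minimal_left_ideal L);
    last first.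
  exists 0; rewrite ?normr0 ?ler01 //; apply: socle_ind => /=.
  - by rewrite mulr0.
  - by move=> x y hx hy; rewrite mulrDr hx hy addr0.
  - by move=> L minL; case: noL; exists L.
have [p [Lp p0 pp Lr]] := minimal_left_ideal_idem ss minL.
have corner := minimal_corner_scalar minL Lp p0 pp Lr.
have [l l1 zp] := dominated_corner p0 pp corner ab.
exists l => //; set z := a - l *: b in zp *.
have zAp v : z * v * p = 0.
  apply: (semiprime ss) => w.
  have -> : z * v * p * w * (z * v * p) = z * v * (p * (w * z * v) * p).
    by rewrite !mulrA.
  by rewrite zp mulr0.
have [[S0 SD SZ SM] SMr] := socle_two_sided (alg A).
pose I := [set x | socle (alg A) x /\ forall v, z * v * x = 0].
have idI : two_sided_ideal I.
  split; first split.
  - by split=> // v; rewrite mulr0.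
  - move=> x y [Sx hx] [Sy hy]; split; first exact: SD.
    by move=> v; rewrite mulrDr hx hy addr0.
  - move=> k x [Sx hx]; split; first exact: SZ.
    by move=> v; rewrite -scalerAr hx scaler0.
  - move=> c x [Sx hx]; split; first exact: SM.
    by move=> v; rewrite mulrA -(mulrA z) hx.
  - move=> x c [Sx hx]; split; first exact: SMr.
    by move=> v; rewrite mulrA hx mul0r.
have Ip : I p by split=> //; exact: socle_minimal Lp.
have [|I0|IS] := minS I idI.
- by move=> x [].
- by move: Ip; rewrite I0 /= => /eqP; rewrite (negbTE p0).
- by move=> x; rewrite -IS => -[_ /(_ 1)]; rewrite mulr1.
Qed.

(** Conversely, let [I] be an ideal strictly between [0] and the socle, and [L] a
    minimal left ideal not inside [I].  Then [I L = 0]; so for nonzero [a] in [I]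
    and [c] in [L], the elements [a x] and [c x] are orthogonal and [a] is
    dominated by [a + c], of which it is not a multiple. *)
Lemma dominated_minimal_socle (R : realType) (A : banachAlgType R[i]) :
  semisimple (alg A) ->
  (forall a b : alg A, socle (alg A) b ->
     (forall x, spectral_radius (a * x) <= spectral_radius (b * x)) ->
     exists l : R[i], a = l *: b) ->
  minimal_two_sided_ideal (socle (alg A)).
Proof.
move=> ss dom; split; first exact: socle_two_sided.
move=> I [idI IMr] IS; have [I0 ID IZ IM] := idI.
have [Iz|/existsNP[a /not_implyP[Ia /eqP a0]]] :=
    pselect (forall x, I x -> x = 0).
  by left; apply/seteqP; split=> [x /Iz|x ->].
right; apply/seteqP; split=> //; apply: socle_ind => // L minL.
apply: contrapT => nLI; have [idL _ _] := minL; have [_ _ LZ LM] := idL.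
have [L0|/existsNP[c0 /not_implyP[[Lc0 Ic0] /eqP c00]]] :=
    pselect (forall x, L x /\ I x -> x = 0); last first.
  apply: nLI; suff <- : [set x | L x /\ I (x * 1)] = L.
    by move=> x [_]; rewrite mulr1.
  apply: (@minimal_left_ideal_eq _ _ _ _ c0) => //.
  - exact: left_idealI_mulr.
  - by move=> x [].
  - by split=> //; rewrite mulr1.
have [c Lc c0] := minimal_left_ideal_neq0 minL.
have Ic x : I x -> x * c = 0.
  by move=> Ix; apply: L0; split; [exact: LM|exact: IMr].
have cI y x : I x -> c * y * x = 0.
  move=> Ix; apply: (semiprime ss) => w.
  have -> : c * y * x * w * (c * y * x) = c * y * (x * w * c) * (y * x).
    by rewrite !mulrA.
  by rewrite Ic ?mulr0 ?mul0r //; exact: IMr.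
have Sac : socle (alg A) (a + c).
  by apply: socleD; [exact: IS|exact: socle_minimal Lc].
have [x|l al] := dom a (a + c) Sac.
  rewrite mulrDl; apply: spectral_radius_orthoD.
  - by rewrite mulrA Ic ?mul0r //; exact: IMr.
  - by rewrite mulrA cI ?mul0r.
have lc : l *: c = 0.
  apply: L0; split; first exact: LZ.
  have -> : l *: c = a - l *: a by rewrite {1}al scalerDr addrAC subrr add0r.
  by apply: left_idealB => //; exact: IZ.
move/eqP: lc; rewrite scaler_eq0 (negbTE c0) orbF => /eqP l0.
by move: a0; rewrite al l0 scale0r eqxx.
Qed.

Theorem theorem2p5 (R : realType) (A : banachAlgType R[i])
    (Ass : semisimple (alg A)) :
  minimal_two_sided_ideal (socle (alg A)) <->
  (forall a b : alg A, socle (alg A) b ->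
     ((forall x : alg A, spectral_radius (a * x) <= spectral_radius (b * x)) <->
      (exists2 l : R[i], `|l| <= 1 & a = l *: b))).
Proof.
split=> [minS a b Sb|dom].
  split=> [ab|[l l1 ->] x]; first exact: minimal_socle_dominated.
  by rewrite -scalerAl spectral_radiusZ // -lecR cabsE.
apply: (dominated_minimal_socle Ass) => a b Sb /(dom a b Sb).1[l _ ->].
by exists l.
Qed.
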